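(* Let $n\geqslant 2$ be an integer and let $\alpha\in(0,2]$, $\alpha<n$. Given $\mu,\nu\in\mathfrak{M}^+$, assume there exists $A\subset\mathbb{R}^n$ which is not inner $\alpha$-thin at infinity, and such that $$\kappa_\alpha\mu\leqslant\kappa_\alpha\nu\quad\text{nearly everywhere on }A.$$ Then $\mu(\mathbb{R}^n)\leqslant\nu(\mathbb{R}^n)$ (as elements of $[0,+\infty]$).
   Context: Kernel and potential: $\kappa_\alpha(x,y):=|x-y|^{\alpha-n}$ is the $\alpha$-Riesz kernel on $\mathbb{R}^n$ ($|x-y|$ the Euclidean distance, $\kappa_\alpha(x,x)=+\infty$). For a positive Radon measure $\mu$ on $\mathbb{R}^n$, $\kappa_\alpha\mu(x):=\int\kappa_\alpha(x,y)\,d\mu(y)\in[0,+\infty]$. $\mathfrak{M}^+$ is the cone of all positive Radon measures $\mu$ on $\mathbb{R}^n$ (possibly with $\mu(\mathbb{R}^n)=+\infty$) such that $\kappa_\alpha\mu$ is not identically $+\infty$; equivalently, $\int_{|y|>1}|y|^{\alpha-n}\,d\mu(y)<\infty$. Inner capacity: a measure $\mu\in\mathfrak{M}^+$ is concentrated on $A\subset\mathbb{R}^n$ if $A^c:=\mathbb{R}^n\setminus A$ is $\mu$-negligible. Let $\mathcal{E}^+_A$ be the set of all $\mu\in\mathfrak{M}^+$ concentrated on $A$ with finite energy $\kappa_\alpha(\mu,\mu):=\int\kappa_\alpha(x,y)\,d(\mu\otimes\mu)(x,y)<\infty$. The inner $\alpha$-Riesz capacity of an arbitrary $A\subset\mathbb{R}^n$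 is $c_\alpha(A):=1/\inf\kappa_\alpha(\mu,\mu)$, the infimum being over all $\mu\in\mathcal{E}^+_A$ with $\mu(\mathbb{R}^n)=1$, with the conventions $\inf\varnothing=+\infty$, $1/(+\infty)=0$, $1/0=+\infty$. A property holds nearly everywhere (n.e.) on $A$ if the set $E$ of all $x\in A$ where it fails satisfies $c_\alpha(E)=0$. Inner $\alpha$-thinness at infinity: $A\subset\mathbb{R}^n$ is inner $\alpha$-thin at infinity if for some (equivalently, every) $y\in\mathbb{R}^n$, $$\sum_{j\in\mathbb{N}}\frac{c_\alpha(A_j)}{q^{j(n-\alpha)}}<\infty,\qquad\text{where } q\in(1,\infty)\text{ and }A_j:=A\cap\{x\in\mathbb{R}^n: q^j\leqslant|x-y|<q^{j+1}\}.$$ Equivalently, there exist $\nu\in\mathfrak{M}^+$ and a constant $c>0$ with $\kappa_\alpha\nu\geqslant c$ n.e. on $A$. *)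

(* Defs.v *)
From HB Require Import structures.
From mathcomp Require Import all_boot all_order all_algebra.
From mathcomp Require Import all_classical all_reals all_analysis.
Set Implicit Arguments.
Unset Strict Implicit.
Unset Printing Implicit Defensive.
Import Order.TTheory GRing.Theory Num.Theory.
Import numFieldNormedType.Exports.
Local Open Scope classical_set_scope.
Local Open Scope ring_scope.

(* The row vectors 'rV[R]_n carry the usual topology of R^n, but the library
   norm on them is the max norm, hence a separate Euclidean distance. *)
Definition edist (R : realType) (n : nat) (x y : 'rV[R]_n) : R :=
  Num.sqrt (\sum_(i < n) (x 0 i - y 0 i) ^+ 2).

Definition borelRn (R : realType) (n : nat) :=
  g_sigma_algebraType (@open 'rV[R]_n).

(* Locally finite Borel measures: on R^n these are automatically inner and
   outer regular. *)
Definition is_radon (R : realType) (n : nat)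
    (mu : {measure set (borelRn R n) -> \bar R}) : Prop :=
  forall K : set 'rV[R]_n, compact K -> (mu K < +oo)%E.

(* The case split is needed because 0 `^ a = 0 for a != 0. *)
Definition riesz_kernel (R : realType) (n : nat) (alpha : R)
    (x y : 'rV[R]_n) : \bar R :=
  if x == y then +oo%E else (edist x y `^ (alpha - n%:R))%:E.

Definition riesz_potential (R : realType) (n : nat) (alpha : R)
    (mu : {measure set (borelRn R n) -> \bar R}) (x : 'rV[R]_n) : \bar R :=
  (\int[mu]_(y in [set: borelRn R n]) riesz_kernel alpha x y)%E.

Definition Mplus (R : realType) (n : nat) (alpha : R)
    (mu : {measure set (borelRn R n) -> \bar R}) : Prop :=
  is_radon mu /\ ~ (forall x : 'rV[R]_n, riesz_potential alpha mu x = +oo%E).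

Definition riesz_energy (R : realType) (n : nat) (alpha : R)
    (mu : {measure set (borelRn R n) -> \bar R}) : \bar R :=
  (\int[mu \x mu]_(z in [set: borelRn R n * borelRn R n])
     riesz_kernel alpha z.1 z.2)%E.

Definition concentrated_on (R : realType) (n : nat)
    (mu : {measure set (borelRn R n) -> \bar R}) (A : set 'rV[R]_n) : Prop :=
  mu.-negligible (~` A).

Definition Eplus (R : realType) (n : nat) (alpha : R) (A : set 'rV[R]_n) :
    set {measure set (borelRn R n) -> \bar R} :=
  [set mu | [/\ Mplus alpha mu, concentrated_on mu A
              & (riesz_energy alpha mu < +oo)%E]].

(* In \bar R the inverse satisfies 0^-1 = +oo and +oo^-1 = 0, and
   ereal_inf set0 = +oo. *)
Definition inner_capacity (R : realType) (n : nat) (alpha : R)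
    (A : set 'rV[R]_n) : \bar R :=
  ((ereal_inf [set riesz_energy alpha mu | mu in
      [set mu | Eplus alpha A mu /\ mu [set: borelRn R n] = 1%E]])^-1)%E.

Definition nearly_everywhere (R : realType) (n : nat) (alpha : R)
    (A : set 'rV[R]_n) (P : 'rV[R]_n -> Prop) : Prop :=
  inner_capacity alpha [set x | A x /\ ~ P x] = 0%E.

Definition shell (R : realType) (n : nat) (q : R) (y : 'rV[R]_n)
    (A : set 'rV[R]_n) (j : nat) : set 'rV[R]_n :=
  A `&` [set x | q ^+ j <= edist x y < q ^+ j.+1].

Definition inner_thin_at_infinity (R : realType) (n : nat) (alpha q : R)
    (A : set 'rV[R]_n) : Prop :=
  exists y : 'rV[R]_n,
    (\sum_(0 <= j <oo)
       (inner_capacity alpha (shell q y A j)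
        / (q `^ (j%:R * (n%:R - alpha)))%:E) < +oo)%E.

(* Main.v *)
From HB Require Import structures.
Require Import Defs.
From mathcomp Require Import all_boot all_order all_algebra.
From mathcomp Require Import all_classical all_reals all_analysis.
From mathcomp Require Import measurable_realfun lebesgue_integral.
From mathcomp Require Import ring lra.
Set Implicit Arguments.
Unset Strict Implicit.
Unset Printing Implicit Defensive.
Import Order.TTheory GRing.Theory Num.Theory.
Import numFieldNormedType.Exports.
Local Open Scope classical_set_scope.
Local Open Scope ring_scope.

(** Write pot m for the Riesz potential of a measure m.  The idea is to test
    the hypothesis pot mu <= pot nu against measures carried by A whose
    potentials are, after normalization, almost constant: if tau is carried by
    A, charges no set of zero capacity, and pot tau is everywhere at most
    about t and on a given large cube B at least about t, then by symmetry of
    the kernel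
      t * mu(B) <~ int (pot tau) dmu = int (pot mu) dtau
                <= int (pot nu) dtau = int (pot tau) dnu <~ t * nu(R^n),
    and B can exhaust the space.

    Such measures tau exist because A is not thin at infinity.  In each shell
    A_j of A there is a finite measure gam_j whose potential is bounded by a
    constant C independent of j and whose mass is at least a quarter of the
    capacity of A_j (capacity_bounded_potential): cut a nearly optimal unit measure down
    to the set where its potential is at most twice a bound of its energy, and
    use the maximum principle (riesz_maximum_principle) to control the
    potential outside that set.  Put tau = gam_N + ... + gam_(M-1) and let
    t = pot tau (0), which is at least a constant times a partial sum of the
    Wiener series, hence tends to infinity with M (unbounded_of_not_thin).

    That pot tau is almost constant is a matter of comparing |x - y| with |y|
    (riesz_kernel_almost_const).  Fix lam > 1.  For y in the j-th annulus,
    |x - y|^(alpha - n) is at most lam |y|^(alpha - n) unless |x| and |y| are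
    of the same order of magnitude, which happens for a number of indices j
    bounded independently of x; each of these contributes at most C to
    pot tau (x).  Thus pot tau <= lam t + K everywhere with K independent of
    M (sum_potential_le), while t <= lam (pot tau) on a fixed cube as soon as
    N is large (sum_potential_ge).  Letting first M tend to infinity, which
    makes K negligible with respect to t, and then lam tend to 1 gives the
    claim (mass_le_of_unbounded).

    Finally each gam_j is carried by A and has a bounded potential, so it does
    not charge the exceptional set where pot mu > pot nu: a restriction of
    gam_j to it would have finite energy (bounded_potential_null). *)

Local Notation edist := Defs.edist.

(** * Euclidean distance and powers of the distance *)

Lemma cauchy_schwarz_sum (R : realType) (n : nat) (a b : 'I_n -> R) :
  \sum_i a i * b i <=
  Num.sqrt (\sum_i a i ^+ 2) * Num.sqrt (\sum_i b i ^+ 2).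
Proof.
set A := Num.sqrt (\sum_i a i ^+ 2); set B := Num.sqrt (\sum_i b i ^+ 2).
have sq0 (c : 'I_n -> R) : 0 <= \sum_i c i ^+ 2.
  by apply: sumr_ge0 => i _; exact: sqr_ge0.
have A2 : A ^+ 2 = \sum_i a i ^+ 2 by rewrite sqr_sqrtr.
have B2 : B ^+ 2 = \sum_i b i ^+ 2 by rewrite sqr_sqrtr.
have zero (c e : 'I_n -> R) : Num.sqrt (\sum_i c i ^+ 2) = 0 ->
    \sum_i c i * e i = 0.
  move=> /eqP; rewrite sqrtr_eq0 => c0.
  have /eqP : \sum_i c i ^+ 2 = 0 by apply/eqP; rewrite eq_le c0 sq0.
  rewrite psumr_eq0 => [/allP c0'|i _]; last exact: sqr_ge0.
  apply: big1 => i _; have := c0' i (mem_index_enum _).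
  by rewrite sqrf_eq0 => /eqP ->; rewrite mul0r.
have [A0|A0] := eqVneq A 0; first by rewrite zero// A0 mul0r.
have [B0|B0] := eqVneq B 0.
  by under eq_bigr do rewrite mulrC; rewrite zero// B0 mulr0.
have Agt : 0 < A by rewrite lt_neqAle eq_sym A0 sqrtr_ge0.
have Bgt : 0 < B by rewrite lt_neqAle eq_sym B0 sqrtr_ge0.
have AB : 0 < A * B by rewrite mulr_gt0.
(* sum the inequalities 2 (B a_i) (A b_i) <= (B a_i)^2 + (A b_i)^2 *)
have : \sum_i 2 * (A * B) * (a i * b i) <=
    \sum_i (B ^+ 2 * a i ^+ 2 + A ^+ 2 * b i ^+ 2).
  apply: ler_sum => i _; rewrite -subr_ge0.
  rewrite (_ : _ - _ = (B * a i - A * b i) ^+ 2) ?sqr_ge0//; ring.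
rewrite -mulr_sumr big_split/= -!mulr_sumr -A2 -B2 => h.
rewrite -(ler_pM2l AB); nra.
Qed.

Section euclidean.
Context (R : realType) (n : nat).
Implicit Types x y z : 'rV[R]_n.

Lemma eucl_dist_ge0 x y : 0 <= edist x y.
Proof. exact: sqrtr_ge0. Qed.

Lemma eucl_distC x y : edist x y = edist y x.
Proof. by rewrite /edist; congr Num.sqrt; apply: eq_bigr => i _; ring. Qed.

Lemma eucl_dist_eq0 x y : (edist x y == 0) = (x == y).
Proof.
rewrite sqrtr_eq0; apply/idP/eqP => [s0|->]; last first.
  by rewrite big1// => i _; rewrite subrr expr0n.
have /eqP : \sum_i (x 0 i - y 0 i) ^+ 2 = 0.
  by apply/eqP; rewrite eq_le s0 sumr_ge0// => i _; exact: sqr_ge0.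
rewrite psumr_eq0 => [/allP s0'|i _]; last exact: sqr_ge0.
apply/rowP => i; have := s0' i (mem_index_enum _).
by rewrite sqrf_eq0 subr_eq0 => /eqP.
Qed.

Lemma eucl_dist_triangle y x z : edist x z <= edist x y + edist y z.
Proof.
have sq0 (c : 'I_n -> R) : 0 <= \sum_i c i ^+ 2.
  by apply: sumr_ge0 => i _; exact: sqr_ge0.
rewrite -(@ler_pXn2r _ 2)// ?nnegrE ?addr_ge0 ?eucl_dist_ge0//.
rewrite sqrrD !sqr_sqrtr//.
have cs := cauchy_schwarz_sum (fun i => x 0 i - y 0 i) (fun i => y 0 i - z 0 i).
apply: (@le_trans _ _ (\sum_i (x 0 i - y 0 i) ^+ 2 +
  (\sum_i (x 0 i - y 0 i) * (y 0 i - z 0 i)) *+ 2 +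
   \sum_i (y 0 i - z 0 i) ^+ 2)).
  rewrite -mulr_natl mulr_sumr -!big_split/=; apply: ler_sum => i _.
  by rewrite le_eqVlt; apply/orP; left; apply/eqP; ring.
by rewrite lerD2r lerD2l lerMn2r.
Qed.

End euclidean.

Section profile.
Context (R : realType) (p : R) (p0 : p < 0).
Implicit Types r s c : R.

(** The Riesz kernel as a function of the distance r, with p = alpha - n; the
    value at 0 is that of the kernel on the diagonal. *)
Definition riesz_profile r : \bar R := if r == 0 then +oo%E else (r `^ p)%:E.

Lemma riesz_profile_ge0 r : (0 <= riesz_profile r)%E.
Proof.
by rewrite /riesz_profile; case: ifP => // _; rewrite lee_fin powR_ge0.
Qed.

Lemma powR_le_neg r s : 0 < r -> r <= s -> s `^ p <= r `^ p.
Proof.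
move=> r0 rs; have s0 := lt_le_trans r0 rs.
rewrite -(opprK p) !(powRN _ (- p)) lef_pV2 ?posrE ?powR_gt0//.
by apply: ge0_ler_powR; rewrite ?nnegrE ?oppr_ge0 ?(ltW p0) ?(ltW r0) ?(ltW s0).
Qed.

Lemma riesz_profile_le r s : 0 <= r -> r <= s ->
  (riesz_profile s <= riesz_profile r)%E.
Proof.
rewrite /riesz_profile le_eqVlt => /orP[/eqP <- _|r0 rs].
  by rewrite eqxx leey.
by rewrite !gt_eqF ?(lt_le_trans r0)// lee_fin powR_le_neg.
Qed.

Lemma riesz_profileM c r : 0 < c -> 0 <= r ->
  riesz_profile (c * r) = ((c `^ p)%:E * riesz_profile r)%E.
Proof.
move=> c0 r0; rewrite /riesz_profile mulf_eq0 (gt_eqF c0)/=.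
have [_|_] := eqVneq r 0; last by rewrite powRM ?EFinM// ltW.
by rewrite gt0_muley// lte_fin powR_gt0.
Qed.

(** The profile is continuous from the right, also at 0 where it is infinite.
    This is what lets near-minimizers of a distance replace minimizers in the
    maximum principle below. *)
Lemma riesz_profile_approx r (M : \bar R) : 0 <= r ->
  (M < riesz_profile r)%E -> exists j, (M < riesz_profile (r + j.+1%:R^-1))%E.
Proof.
move=> r0; case: M => [M| |]; last 2 first.
- by move=> h; have := lt_le_trans h (leey _).
- by move=> _; exists 0%N; rewrite (lt_le_trans _ (riesz_profile_ge0 _)) ?ltNy0.
move=> Mr.
have [M0|M0] := leP M 0.
  exists 0%N; rewrite /riesz_profile gt_eqF; last by rewrite ltr_wpDl.
  by rewrite lte_fin; apply/(le_lt_trans M0)/powR_gt0/ltr_wpDl.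
have ip : p^-1 * p = 1 by rewrite mulVf ?lt_eqF.
(* the radius at which the profile takes the value M *)
pose s := M `^ p^-1.
have s0 : 0 < s by rewrite powR_gt0.
have sM : s `^ p = M by rewrite -powRrM ip powRr1// ltW.
have rs : r < s.
  rewrite ltNge; apply/negP => sr; move: Mr.
  rewrite /riesz_profile gt_eqF ?(lt_le_trans s0)// lte_fin -sM ltNge.
  by rewrite powR_le_neg.
have [j js] := ltr_add_invr rs.
have rj : 0 < r + j.+1%:R^-1 by rewrite ltr_wpDl.
exists j; rewrite /riesz_profile gt_eqF// lte_fin -sM.
rewrite -(opprK p) !(powRN _ (- p)) ltf_pV2 ?posrE ?powR_gt0//.
by apply: gt0_ltr_powR; rewrite ?nnegrE ?oppr_gt0 ?ltW//.
Qed.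

End profile.

(** * Sigma-finiteness and restriction of measures *)

(** An alias of m, so that the sigma-finite structure can be attached to a
    measure that is only known to be sigma-finite by a hypothesis. *)
Section as_sigma_finite.
Context d (T : measurableType d) (R : realType).
Implicit Type m : {measure set T -> \bar R}.

Definition as_sigma_finite m (_ : sigma_finite setT m) : set T -> \bar R := m.

HB.instance Definition _ m (mfin : sigma_finite setT m) :=
  Measure.copy (as_sigma_finite mfin) m.
HB.instance Definition _ m (mfin : sigma_finite setT m) :=
  Measure_isSigmaFinite.Build _ _ _ (as_sigma_finite mfin) mfin.

Lemma ex_sigma_finite_measure m : sigma_finite setT m ->
  exists m' : {sigma_finite_measure set T -> \bar R},
    (m' : {measure set T -> \bar R}) = m.
Proof.
move=> mfin; exists (as_sigma_finite mfin).
exact: eq_measure.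
Qed.

End as_sigma_finite.

Lemma finite_sigma_finite d (T : measurableType d) (R : realType)
    (m : {measure set T -> \bar R}) :
  (m setT < +oo)%E -> sigma_finite setT m.
Proof.
by move=> moo; exists (fun=> setT) => //; rewrite bigcup_const//; exists 0%N.
Qed.

Section measures.
Context d (T : measurableType d) (R : realType).
Local Open Scope ereal_scope.

Lemma integral_mrestr (mu : {measure set T -> \bar R}) (F : set T)
    (mF : measurable F) (f : T -> \bar R) : measurable_fun setT f ->
  (forall x, 0 <= f x) ->
  \int[mrestr mu mF]_(x in setT) f x = \int[mu]_(x in F) f x.
Proof.
move=> mf f0.
rewrite (@ge0_negligible_integral _ _ _ (mrestr mu mF) setT (~` F))//.
- rewrite setTD setCK; apply: eq_measure_integral => A mA AF.
  by rewrite /= /mrestr (setIidl AF).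
- exact: measurableC.
- by rewrite /= /mrestr setICl measure0.
Qed.

(** Both the extremal measures and the measures that witness positive capacity
    are obtained from a given one by cutting it down to a set and rescaling. *)
Lemma ex_scaled_restriction (mu : {measure set T -> \bar R}) (F : set T)
    (t : R) : measurable F -> (0 <= t)%R ->
  exists gam : {measure set T -> \bar R},
    (forall A, gam A = t%:E * mu (A `&` F)) /\
    (forall f : T -> \bar R, measurable_fun setT f -> (forall x, 0 <= f x) ->
       \int[gam]_(x in setT) f x = t%:E * \int[mu]_(x in F) f x).
Proof.
move=> mF t0.
exists (mscale (NngNum t0) (mrestr mu mF)); split=> [A|f mf f0].
  by rewrite /= /mscale/=.
by rewrite ge0_integral_mscale// integral_mrestr.
Qed.

Lemma ge0_integral_bounded (mu : {measure set T -> \bar R}) (f : T -> \bar R)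
    (C : \bar R) : measurable_fun setT f -> (forall x, 0 <= f x) ->
  0 <= C -> (forall x, f x <= C) -> \int[mu]_(x in setT) f x <= C * mu setT.
Proof.
move=> mf f0 C0 fC; rewrite -integral_cst//.
by apply: ge0_le_integral => //; exact: measurable_cst.
Qed.

End measures.

(** * Measurability and symmetry of the Riesz kernel *)

Lemma measurable_riesz_profile (R : realType) (p : R) :
  measurable_fun [set: R] (fun r : R => riesz_profile p r).
Proof.
apply: measurable_fun_ifT => //=.
- exact: measurable_fun_eqr.
- by apply/measurable_EFinP; exact: measurable_powR.
Qed.

Section borel.
Context (R : realType) (n : nat).
Local Notation T := (borelRn R n).

Lemma open_borelRn (U : set 'rV[R]_n) : open U -> measurable (U : set T).
Proof. by move=> oU; exact: sub_sigma_algebra. Qed.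

Lemma closed_borelRn (F : set 'rV[R]_n) : closed F -> measurable (F : set T).
Proof.
move=> cF; rewrite -[F]setCK; apply: measurableC; apply: open_borelRn.
exact: closed_openC.
Qed.

Lemma compact_borelRn (K : set 'rV[R]_n) : compact K -> measurable (K : set T).
Proof.
move=> cK; apply: closed_borelRn; exact: compact_closed.
Qed.

Lemma measurable_coord (i : 'I_n) :
  measurable_fun [set: T] (fun x : T => (x : 'rV[R]_n) 0 i).
Proof.
apply: (measurability _ (RGenOpens.measurableE R)).
move=> _ [_ [a [b ->] <-]]; rewrite setTI; apply: open_borelRn.
have /continuousP : continuous (fun x : 'rV[R]_n => x 0 i).
  exact: coord_continuous.
by apply; exact: interval_open.
Qed.

Lemma measurable_edist :
  measurable_fun [set: T * T] (fun z : T * T => edist z.1 z.2).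
Proof.
apply: (@measurableT_comp _ _ _ _ _ _ (@Num.sqrt R)) => //=.
  apply: continuous_measurable_fun; exact: sqrt_continuous.
apply: measurable_sum => i; apply: measurable_funX; apply: measurable_funB.
- exact: measurableT_comp (measurable_coord i) measurable_fst.
- exact: measurableT_comp (measurable_coord i) measurable_snd.
Qed.

Context (alpha : R).

Lemma riesz_kernelE (x y : 'rV[R]_n) :
  riesz_kernel alpha x y = riesz_profile (alpha - n%:R) (edist x y).
Proof. by rewrite /riesz_kernel /riesz_profile eucl_dist_eq0. Qed.

Lemma riesz_kernel_ge0 (x y : 'rV[R]_n) : (0 <= riesz_kernel alpha x y)%E.
Proof. by rewrite riesz_kernelE riesz_profile_ge0. Qed.

Lemma riesz_kernelC (x y : 'rV[R]_n) :
  riesz_kernel alpha x y = riesz_kernel alpha y x.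
Proof. by rewrite !riesz_kernelE eucl_distC. Qed.

Lemma measurable_riesz_kernel :
  measurable_fun [set: T * T] (fun z : T * T => riesz_kernel alpha z.1 z.2).
Proof.
under eq_fun do rewrite riesz_kernelE.
exact: measurableT_comp (measurable_riesz_profile _) measurable_edist.
Qed.

Lemma measurable_riesz_kernelr (x : 'rV[R]_n) :
  measurable_fun [set: T] (fun y : T => riesz_kernel alpha x y).
Proof.
exact: measurableT_comp measurable_riesz_kernel (measurable_pair1 (x : T)).
Qed.

Lemma riesz_potential_ge0 (mu : {measure set T -> \bar R}) x :
  (0 <= riesz_potential alpha mu x)%E.
Proof. by apply: integral_ge0 => y _; exact: riesz_kernel_ge0. Qed.

Lemma measurable_riesz_potential (mu : {measure set T -> \bar R}) :
  sigma_finite setT mu ->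
  measurable_fun [set: T] (riesz_potential alpha mu : T -> \bar R).
Proof.
move=> /ex_sigma_finite_measure[m <-].
exact: (measurable_fun_fubini_tonelli_F (m2 := m)
  (fun z : T * T => riesz_kernel alpha z.1 z.2) measurable_riesz_kernel
  (fun z => riesz_kernel_ge0 _ _)).
Qed.

(** Tonelli's theorem for the symmetric kernel: the mutual energy of two
    measures does not depend on their order. *)
Lemma integral_riesz_potentialC (mu nu : {measure set T -> \bar R}) :
  sigma_finite setT mu -> sigma_finite setT nu ->
  (\int[mu]_(x in [set: T]) riesz_potential alpha nu x =
   \int[nu]_(x in [set: T]) riesz_potential alpha mu x)%E.
Proof.
move=> /ex_sigma_finite_measure[m1 <-] /ex_sigma_finite_measure[m2 <-].
transitivity (\int[m2]_(y in [set: T]) \int[m1]_(x in [set: T])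
    riesz_kernel alpha x y)%E.
  exact: (fubini_tonelli (fun z : T * T => riesz_kernel alpha z.1 z.2)
    measurable_riesz_kernel (fun z => riesz_kernel_ge0 _ _)).
apply: eq_integral => y _; apply: eq_integral => x _; exact: riesz_kernelC.
Qed.

Lemma riesz_energyE (mu : {measure set T -> \bar R}) :
  sigma_finite setT mu ->
  (riesz_energy alpha mu =
   \int[mu]_(x in [set: T]) riesz_potential alpha mu x)%E.
Proof.
move=> /ex_sigma_finite_measure[m <-].
exact: (fubini_tonelli1 (m1 := m) (m2 := m)
  (fun z : T * T => riesz_kernel alpha z.1 z.2)
  measurable_riesz_kernel (fun z => riesz_kernel_ge0 _ _)).
Qed.

End borel.

(** * Cubes and the maximum principle *)

Section radon.
Context (R : realType) (n : nat).
Local Notation T := (borelRn R n).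

Definition cube (k : R) : set 'rV[R]_n := [set x | `|x| <= k].

Lemma closed_cube k : closed (cube k).
Proof.
rewrite (_ : cube k = (fun x : 'rV[R]_n => `|x|) @^-1` [set r | r <= k])//.
apply: closed_comp; last exact: closed_le.
by move=> x _; exact: norm_continuous.
Qed.

Lemma compact_cube k : compact (cube k).
Proof.
apply: bounded_closed_compact; last exact: closed_cube.
exists k; split; first exact: num_real.
by move=> M kM x /= xk; rewrite (le_trans xk)// ltW.
Qed.

Lemma bigcup_cube : \bigcup_k cube k%:R = [set: 'rV[R]_n].
Proof.
apply/seteqP; split=> // x _; exists (Num.truncn `|x|).+1 => //=.
by rewrite /cube/= ltW// truncnS_gt.
Qed.

Lemma radon_sigma_finite (mu : {measure set T -> \bar R}) :
  is_radon mu -> sigma_finite setT mu.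
Proof.
move=> rmu; exists (fun k : nat => cube k%:R : set T).
  by rewrite -bigcup_cube.
move=> k; split; first by apply: closed_borelRn; exact: closed_cube.
by apply: rmu; exact: compact_cube.
Qed.

Lemma edist0_cube k (x : 'rV[R]_n) : cube k x -> edist 0 x <= n%:R * k.
Proof.
move=> xk.
have k0 : 0 <= k by exact: le_trans (normr_ge0 x) xk.
have xik (i : 'I_n) : `|x 0 i| <= k.
  apply: le_trans xk; rewrite [leRHS]/Num.norm/= mx_normrE.
  exact: (le_bigmax _ (fun i : 'I_1 * 'I_n => `|x i.1 i.2|) (0, i)).
have ed0 : 0 <= edist 0 x by exact: eucl_dist_ge0.
rewrite -(@ler_pXn2r _ 2)// ?nnegrE ?mulr_ge0//.
rewrite sqr_sqrtr; last by apply: sumr_ge0 => i _; exact: sqr_ge0.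
apply: (@le_trans _ _ (\sum_(i < n) k ^+ 2)).
  apply: ler_sum => i _; rewrite mxE sub0r sqrrN -real_normK ?num_real//.
  by rewrite ler_pXn2r ?nnegrE.
rewrite sumr_const card_ord exprMn -[leLHS]mulr_natl ler_wpM2r ?exprn_ge0//.
by rewrite -natrX ler_nat -mulnn; case: (n) => // m; rewrite leq_pmulr.
Qed.

End radon.

Section maximum_principle.
Context (R : realType) (n : nat) (alpha : R) (an : alpha < n%:R).
Local Notation T := (borelRn R n).
Local Notation p := (alpha - n%:R).
Local Open Scope ereal_scope.

Let p0 : (p < 0)%R. Proof. by rewrite subr_lt0. Qed.

(** Ugaheri's maximum principle: if z is a point of F nearest to x, then
    |z - y| <= |x - z| + |x - y| <= 2 |x - y| for all y in F, so the kernel seen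
    from x is at most 2^(n - alpha) times the kernel seen from z.  A nearest
    point need not exist, since F is only measurable; one takes points z_j of
    F at distance less than inf + 1/(j+1) from x, for which
    |z_j - y| <= 2 |x - y| + 1/(j+1), and passes to the limit by monotone
    convergence. *)
Lemma riesz_maximum_principle (mu : {measure set T -> \bar R}) (F : set T)
    (V : \bar R) : measurable F -> F !=set0 ->
  (forall x, F x -> \int[mu]_(y in F) riesz_kernel alpha x y <= V) ->
  forall x : 'rV[R]_n,
    \int[mu]_(y in F) riesz_kernel alpha x y <= (2 `^ (- p))%:E * V.
Proof.
move=> mF [z0 Fz0] hV x.
pose dF := [set edist x z | z in (F : set 'rV[R]_n)].
have dF0 : dF !=set0 by exists (edist x z0), z0.
have lbF : lbound dF 0%R by move=> _ [z _ <-]; exact: eucl_dist_ge0.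
have hinf : has_inf dF by split => //; exists 0%R.
pose D := inf dF.
have D_le y : F y -> (D <= edist x y)%R.
  by move=> Fy; apply: (ge_inf hinf.2); exists y.
pose f (j : nat) (y : T) : \bar R :=
  riesz_profile p (2 * edist x y + j.+1%:R^-1).
have mf j : measurable_fun F (f j).
  apply: measurable_funTS.
  apply: (measurableT_comp (measurable_riesz_profile p)).
  apply: measurable_funD => //; apply: measurable_funM => //.
  exact: measurableT_comp (@measurable_edist R n) (measurable_pair1 (x : T)).
have f0 j y : 0 <= f j y by exact: riesz_profile_ge0.
have fnd y : nondecreasing_seq (f ^~ y).
  move=> i j ij; apply: riesz_profile_le => //.
    by rewrite addr_ge0// mulr_ge0// eucl_dist_ge0.
  by rewrite lerD2l lef_pV2 ?posrE// ler_nat ltnS.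
have fV j : \int[mu]_(y in F) f j y <= V.
  have invSn_gt0 : (0 < j.+1%:R^-1 :> R)%R by [].
  have [_ [z Fz <-] zD] := inf_adherent invSn_gt0 hinf.
  apply: le_trans (hV z Fz); apply: ge0_le_integral => //.
  - by apply: measurable_funTS; exact: measurable_riesz_kernelr.
  - move=> y Fy; rewrite riesz_kernelE; apply: riesz_profile_le => //.
      exact: eucl_dist_ge0.
    have := eucl_dist_triangle x z y; rewrite (eucl_distC z x).
    move: (D_le _ Fy) zD; rewrite -/D.
    move: (D) (j.+1%:R^-1)%R (edist x y) (edist x z) (edist z y) => *; lra.
have cvf : \int[mu]_(y in F) f j y @[j --> \oo] -->
    \int[mu]_(y in F) limn (f ^~ y).
  by apply: cvg_monotone_convergence => // y _; exact: fnd.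
have limV : \int[mu]_(y in F) limn (f ^~ y) <= V.
  rewrite -(cvg_lim _ cvf)//; apply: lime_le; first by apply/cvg_ex; eexists; exact: cvf.
  by apply: nearW => j; exact: fV.
have le_lim y : (2 `^ p)%:E * riesz_kernel alpha x y <= limn (f ^~ y).
  rewrite riesz_kernelE -riesz_profileM ?eucl_dist_ge0//.
  rewrite leNgt; apply/negP => /riesz_profile_approx[] //.
    by rewrite mulr_ge0// eucl_dist_ge0.
  move=> j; rewrite ltNge => /negP; apply.
  have -> : limn (f ^~ y) = ereal_sup (range (f ^~ y)).
    by apply/cvg_lim => //; exact: ereal_nondecreasing_cvgn.
  by apply: ereal_sup_ubound; exists j.
have mk : measurable_fun F (fun y : T => riesz_kernel alpha x y).
  by apply: measurable_funTS; exact: measurable_riesz_kernelr.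
have : \int[mu]_(y in F) ((2 `^ p)%:E * riesz_kernel alpha x y) <= V.
  apply: le_trans limV; apply: ge0_le_integral => //.
  - by move=> y _; rewrite mule_ge0 ?lee_fin ?powR_ge0// riesz_kernel_ge0.
  - by apply: measurable_funeM.
  - apply: (emeasurable_fun_cvg (fun j => f j)) => // y _.
    by apply: ereal_nondecreasing_is_cvgn.
rewrite ge0_integralZl_EFin ?powR_ge0//; last by move=> y _; exact: riesz_kernel_ge0.
rewrite -lee_pdivlMl ?powR_gt0//.
by rewrite powRN.
Qed.

End maximum_principle.

(** * Measures with bounded potential and capacity *)

Section capacity.
Context (R : realType) (n : nat) (alpha : R) (an : alpha < n%:R).
Local Notation T := (borelRn R n).
Local Notation p := (alpha - n%:R).
Local Open Scope ereal_scope.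

Lemma inner_capacity_gtP (A : set 'rV[R]_n) (t : R) : (0 < t)%R ->
  t%:E < inner_capacity alpha A ->
  exists mu : {measure set T -> \bar R},
    [/\ Eplus alpha A mu, mu setT = 1 & riesz_energy alpha mu < t^-1%:E].
Proof.
move=> t0; rewrite /inner_capacity; set S := [set _ | _ in _] => tS.
have : ereal_inf S < t^-1%:E.
  move: tS; case: (ereal_inf S) => [r| |] //=; last by rewrite invey lte_fin ltNge ltW.
  rewrite inver; have [->|r0] := eqVneq r 0%R; first by rewrite !lte_fin invr_gt0.
  rewrite !lte_fin => tr; have ri : (0 < r^-1)%R by exact: lt_trans tr.
  by rewrite -[ltLHS]invrK ltf_pV2.
by move=> /ereal_inf_lt[_ [mu [Emu mu1] <-] h]; exists mu.
Qed.

(** A unit measure mu on A of energy less than 1/t has, by Markov's inequality,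
    at least half of its mass on the set F where its potential is at most 2/t.
    Take gam to be t times the restriction of mu to F: its potential is at most
    2 on F, hence at most 2 * 2^(n - alpha) everywhere by the maximum
    principle. *)
Lemma capacity_bounded_potential (A : set 'rV[R]_n) (t : R) : (0 < t)%R ->
  t%:E < inner_capacity alpha A ->
  exists gam : {measure set T -> \bar R},
    [/\ concentrated_on gam A, (t / 2)%:E <= gam setT, gam setT < +oo &
      forall x, riesz_potential alpha gam x <= (2 `^ (- p) * 2)%:E].
Proof.
move=> t0 /(inner_capacity_gtP t0)[mu [[Mmu [N [mN N0 AN]] _] mu1 energy]].
have smu : sigma_finite setT mu.
  by apply: finite_sigma_finite; rewrite mu1 ltry.
have mpot : measurable_fun setT (riesz_potential alpha mu : T -> \bar R).
  exact: measurable_riesz_potential.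
pose V : R := (2 / t)%R.
have V0 : (0 < V)%R by rewrite divr_gt0.
pose F : set T := [set x : T | riesz_potential alpha mu x <= V%:E].
have mF : measurable F.
  by rewrite /F -[X in measurable X]setTI; exact: emeasurable_fun_infty_c.
have mFC : measurable (~` F) by exact: measurableC.
have muFC : mu (~` F) <= (2^-1)%:E.
  have : V%:E * mu (~` F) <= t^-1%:E.
    apply: le_trans (ltW energy); rewrite riesz_energyE//.
    apply: (@le_trans _ _ (\int[mu]_(x in ~` F) riesz_potential alpha mu x)).
      rewrite -integral_cst//; apply: ge0_le_integral => //.
      - by move=> x _; rewrite lee_fin ltW.
      - exact: measurable_funTS.
      - by move=> x /= /negP; rewrite -ltNge => /ltW.
    apply: ge0_subset_integral => //.
    by move=> x _; exact: riesz_potential_ge0.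
  rewrite -lee_pdivlMl//; congr (_ <= _).
  by rewrite -EFinM /V invf_div; congr EFin; field; rewrite gt_eqF.
have muF : (2^-1)%:E <= mu F.
  have : 1 = mu F + mu (~` F).
    by rewrite -mu1 -measureU//; [rewrite setUv|rewrite setICr].
  have : mu (~` F) \is a fin_num.
    by rewrite ge0_fin_numE// (le_lt_trans muFC)// ltry.
  have : mu F \is a fin_num.
    rewrite ge0_fin_numE// (@le_lt_trans _ _ 1) ?ltry//.
    by rewrite -mu1 le_measure ?inE.
  move: muFC; case: (mu F) => // a; case: (mu (~` F)) => // b.
  by rewrite !lee_fin -EFinD => + _ _ [] ?; lra.
have F0 : F !=set0.
  apply/set0P/eqP => F0; move: muF; rewrite F0 measure0 lee_fin.
  by rewrite leNgt invr_gt0 ltr0n.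
have [gam [gamE intgam]] := ex_scaled_restriction mu mF (ltW t0).
exists gam; split.
- exists N; split => //; rewrite gamE.
  suff -> : mu (N `&` F) = 0 by rewrite mule0.
  apply/eqP; rewrite eq_le measure_ge0 andbT -N0.
  by apply: le_measure; rewrite ?inE//; exact: measurableI.
- by rewrite gamE setTI EFinM lee_pmul2l// lte_fin.
- rewrite gamE setTI; have : mu F <= 1 by rewrite -mu1 le_measure ?inE.
  move=> muF1; apply: (@le_lt_trans _ _ (t%:E * 1)); last by rewrite mule1 ltry.
  by rewrite lee_pmul2l// lte_fin.
- move=> x; rewrite /riesz_potential intgam; last 2 first.
  + exact: measurable_riesz_kernelr.
  + by move=> y; exact: riesz_kernel_ge0.
  have := riesz_maximum_principle an mF F0 (mu := mu) (V := V%:E).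
  move=> /(_ _ x) h; apply: (@le_trans _ _ (t%:E * ((2 `^ (- p))%:E * V%:E))).
    rewrite lee_pmul2l//; apply: h => z Fz; apply: le_trans Fz.
    apply: ge0_subset_integral => //.
    + exact: measurable_riesz_kernelr.
    + by move=> y _; exact: riesz_kernel_ge0.
  rewrite -!EFinM lee_fin le_eqVlt; apply/orP; left; apply/eqP.
  by rewrite /V; field; rewrite gt_eqF.
Qed.

(** If gam charged D, its normalized restriction to D would be a unit measure
    concentrated on the intersection of A and D whose energy is at most the
    bound on its potential, so this intersection would have positive
    capacity. *)
Lemma bounded_potential_null (gam : {measure set T -> \bar R})
    (A D : set 'rV[R]_n) (C : R) :
  gam setT < +oo -> concentrated_on gam A ->
  (forall x, riesz_potential alpha gam x <= C%:E) ->
  measurable (D : set T) -> inner_capacity alpha (A `&` D) = 0 ->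
  gam D = 0.
Proof.
move=> gamoo [N [mN N0 AN]] gamC mD; rewrite /inner_capacity.
set S := [set _ | _ in _] => /eqP; rewrite inve_eq0 => /eqP infS.
apply: contrapT => /eqP gamD0.
have gamDfin : gam D \is a fin_num.
  by rewrite ge0_fin_numE// (le_lt_trans _ gamoo)// le_measure ?inE.
pose m := fine (gam D).
have gamDE : gam D = m%:E by rewrite fineK.
have m0 : (0 < m)%R by rewrite -lte_fin -gamDE lt0e gamD0/=.
have im0 : (0 < m^-1)%R by rewrite invr_gt0.
have [del [delE intdel]] := ex_scaled_restriction gam mD (ltW im0).
have del1 : del setT = 1.
  by rewrite delE setTI gamDE -EFinM mulVf// gt_eqF.
have sdel : sigma_finite setT del.
  by apply: finite_sigma_finite; rewrite del1 ltry.
have C0 : (0 <= C)%R.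
  by rewrite -lee_fin (le_trans _ (gamC 0%R))// riesz_potential_ge0.
have delC x : riesz_potential alpha del x <= (m^-1 * C)%:E.
  rewrite /riesz_potential intdel; last 2 first.
  + exact: measurable_riesz_kernelr.
  + by move=> y; exact: riesz_kernel_ge0.
  rewrite EFinM lee_pmul2l ?lte_fin//; apply: le_trans (gamC x).
  apply: ge0_subset_integral => //.
  + exact: measurable_riesz_kernelr.
  + by move=> y _; exact: riesz_kernel_ge0.
have energy : riesz_energy alpha del < +oo.
  apply: (@le_lt_trans _ _ ((m^-1 * C)%:E)); last exact: ltry.
  rewrite riesz_energyE// -[leRHS]mule1 -del1.
  apply: ge0_integral_bounded => //.
  - exact: measurable_riesz_potential.
  - by move=> x; exact: riesz_potential_ge0.
  - by rewrite lee_fin mulr_ge0// ltW.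
have : +oo <= riesz_energy alpha del.
  rewrite -infS; apply: ereal_inf_lbound; exists del => //; split => //; split => //.
  - split.
    + move=> K cK; apply: (@le_lt_trans _ _ 1); last exact: ltry.
      rewrite -del1 le_measure ?inE//.
      exact: compact_borelRn.
    + by move=> /(_ 0%R) h; have := delC 0%R; rewrite h leye_eq.
  - exists (N `|` ~` D); split => /=.
    + by apply: measurableU => //; exact: measurableC.
    + rewrite delE setIUl setICl setU0.
      suff -> : gam (N `&` D) = 0 by rewrite mule0.
      apply/eqP; rewrite eq_le measure_ge0 andbT -N0.
      by apply: le_measure; rewrite ?inE//; exact: measurableI.
    + rewrite setCI; apply: setSU; exact: AN.
by rewrite leNgt energy.
Qed.

End capacity.

(** * The kernel for distant arguments *)

Section kernel_at_infinity.
Context (R : realType) (n : nat) (alpha : R) (an : alpha < n%:R).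
Local Notation T := (borelRn R n).
Local Notation p := (alpha - n%:R).

Let p0 : p < 0. Proof. by rewrite subr_lt0. Qed.

(** With e > 1 such that e^(n - alpha) = lam, it suffices to have
    e^-1 |y| <= |x - y|, resp. |x - y| <= e |y|; by the triangle inequality
    this holds once |x| <= (1 - e^-1) |y|, and the lower bound also holds once
    |x| >= 2 |y|. *)
Lemma riesz_kernel_almost_const (lam : R) : 1 < lam ->
  exists2 L, 1 <= L & forall x y : 'rV[R]_n,
    (L * edist 0 x <= edist 0 y ->
      (riesz_kernel alpha 0 y <= lam%:E * riesz_kernel alpha x y)%E) /\
    (L * edist 0 x <= edist 0 y \/ L * edist 0 y <= edist 0 x ->
      (riesz_kernel alpha x y <= lam%:E * riesz_kernel alpha 0 y)%E).
Proof.
move=> lam1; have lam0 : 0 < lam by exact: lt_trans lam1.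
pose e := lam `^ (- p^-1).
have p'0 : 0 < - p^-1 by rewrite oppr_gt0 invr_lt0.
have e1 : 1 < e.
  apply: (@le_lt_trans _ _ (1 `^ (- p^-1))); first by rewrite powR1.
  by apply: gt0_ltr_powR; rewrite // nnegrE ltW.
have e0 : 0 < e by exact: lt_trans e1.
have ep : e `^ p = lam^-1.
  by rewrite -powRrM mulNr mulVf ?lt_eqF// powRN powRr1// ltW.
have iep : e^-1 `^ p = lam.
  by rewrite -powR_inv1 ?ltW// powRAC ep powR_inv1 ?invr_ge0 ?ltW// invrK.
have ie0 : 0 < e^-1 by rewrite invr_gt0.
have ie1 : e^-1 < 1 by rewrite invf_lt1.
pose u := 1 - e^-1.
have u0 : 0 < u by rewrite subr_gt0.
have uE : 1 - u = e^-1 by rewrite /u opprB addrC subrK.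
have Lu : (u^-1 + 1) * u = 1 + u by rewrite mulrDl mulVf ?gt_eqF// mul1r.
have uV : 1 < u^-1 by rewrite invf_gt1// /u ltrBlDr ltrDl.
have eu : 1 + u <= e.
  rewrite -[e]invrK -[e^-1]uE -[leRHS]mul1r ler_pdivlMr ?uE//.
  by rewrite -uE; nra.
exists (u^-1 + 1); first by rewrite lerDr ltW// invr_gt0.
move=> x y.
set a := edist 0 x; set b := edist 0 y; set c := edist x y.
have [a0 b0 c0] : [/\ 0 <= a, 0 <= b & 0 <= c].
  by split; exact: eucl_dist_ge0.
have abc : c <= a + b.
  by have := eucl_dist_triangle 0 x y; rewrite (eucl_distC x 0).
have bac : b <= a + c by exact: eucl_dist_triangle.
have acb : a <= b + c.
  by have := eucl_dist_triangle y 0 x; rewrite (eucl_distC y x).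
have far : (u^-1 + 1) * a <= b -> a <= u * b.
  by move=> h; rewrite mulrC -ler_pdivrMr// mulrC; apply: le_trans h; nra.
rewrite !riesz_kernelE -/a -/b -/c; split=> [/far aub|hab].
  have : (riesz_profile p (e * b) <= riesz_profile p c)%E.
    by apply: riesz_profile_le => //; nra.
  by rewrite riesz_profileM// ep lee_pdivrMl.
rewrite -iep -riesz_profileM//; apply: riesz_profile_le => //.
  by rewrite mulr_ge0// ltW.
rewrite -uE.
case: hab => [/far|]; nra.
Qed.

Lemma potential_compare (gam : {measure set T -> \bar R}) (S : set T) (c : R)
    (x x' : 'rV[R]_n) : measurable S -> gam (~` S) = 0%E -> 0 <= c ->
  (forall y, S y ->
    (riesz_kernel alpha x y <= c%:E * riesz_kernel alpha x' y)%E) ->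
  (riesz_potential alpha gam x <= c%:E * riesz_potential alpha gam x')%E.
Proof.
move=> mS S0 c0 h; rewrite /riesz_potential -ge0_integralZl_EFin//; last 2 first.
- by move=> y _; exact: riesz_kernel_ge0.
- exact: measurable_riesz_kernelr.
apply: ae_ge0_le_integral => //.
- by move=> y _; exact: riesz_kernel_ge0.
- exact: measurable_riesz_kernelr.
- by move=> y _; rewrite mule_ge0 ?lee_fin// riesz_kernel_ge0.
- by apply: measurable_funeM; exact: measurable_riesz_kernelr.
exists (~` S); split => //; first exact: measurableC.
by move=> y /= hy Sy; apply: hy => _; exact: h.
Qed.

Lemma potential_ge_mass (gam : {measure set T -> \bar R}) (S : set T) (c : R)
    (x : 'rV[R]_n) : measurable S -> gam (~` S) = 0%E -> 0 <= c ->
  (forall y, S y -> edist x y <= c) ->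
  ((c `^ p)%:E * gam setT <= riesz_potential alpha gam x)%E.
Proof.
move=> mS S0 c0 h; rewrite -integral_cst//.
apply: ae_ge0_le_integral => //.
- by move=> y _; rewrite lee_fin powR_ge0.
- by move=> y _; exact: riesz_kernel_ge0.
- exact: measurable_riesz_kernelr.
exists (~` S); split => //; first exact: measurableC.
move=> y /= hy Sy; apply: hy => _; rewrite riesz_kernelE.
have := riesz_profile_le p0 (eucl_dist_ge0 x y) (h _ Sy).
apply: le_trans; rewrite /riesz_profile; case: ifP => // _.
exact: leey.
Qed.

End kernel_at_infinity.

(** The number of shells at which the kernel is not controlled by its value at
    the origin is bounded by this counting argument. *)
Lemma sum_bool_window (b : pred nat) (m N M : nat) :
  (forall i j, b i -> b j -> (i <= j)%N -> (j < i + m)%N) ->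
  (\sum_(N <= j < M) b j <= m)%N.
Proof.
move=> bm.
have -> : (\sum_(N <= j < M) b j = count b (index_iota N M))%N.
  by rewrite -sum1_count [RHS]big_mkcond.
have [/hasP[i0 _ bi0]|/hasPn nb] := boolP (has b (index_iota N M)); last first.
  by rewrite (eq_in_count (a2 := pred0)) ?count_pred0// => j /nb /negbTE.
(* all the indices counted lie in the window of length m after the first one *)
have [i bi mini] := ex_minnP (ex_intro b i0 bi0).
rewrite -size_filter -[leqRHS](size_iota i).
apply: uniq_leq_size; first by rewrite filter_uniq ?iota_uniq.
move=> j; rewrite mem_filter mem_iota => /andP[bj _].
by rewrite mini//= bm// mini.
Qed.

(** * Measures carried by the shells *)

Section shells.
Context (R : realType) (n : nat) (alpha : R) (an : alpha < n%:R).
Context (q : R) (q1 : 1 < q).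
Local Notation T := (borelRn R n).
Local Notation p := (alpha - n%:R).
Local Open Scope ereal_scope.

Let p0 : (p < 0)%R. Proof. by rewrite subr_lt0. Qed.
Let q0 : (0 < q)%R. Proof. exact: lt_trans q1. Qed.

Definition annulus (j : nat) : set 'rV[R]_n :=
  [set x | (q ^+ j <= edist 0 x < q ^+ j.+1)%R].

Lemma shellE A j : shell q 0%R A j = A `&` annulus j.
Proof.
rewrite /shell /annulus; congr (A `&` _).
by apply/seteqP; split => x /=; rewrite eucl_distC.
Qed.

Lemma measurable_annulus j : measurable (annulus j : set T).
Proof.
have me : measurable_fun [set: T] (fun y : T => edist 0 y).
  exact: measurableT_comp (@measurable_edist R n) (measurable_pair1 (0%R : T)).
rewrite (_ : annulus j = [set: T] `&`
    (fun y : T => edist 0 y) @^-1` `[(q ^+ j)%R, (q ^+ j.+1)%R[%classic).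
  by apply: me => //; exact: measurable_itv.
by apply/seteqP; split => x /=; rewrite in_itv/= => // -[].
Qed.

Lemma concentrated_annulus (gam : {measure set T -> \bar R}) A j :
  concentrated_on gam (shell q 0%R A j) -> gam (~` annulus j) = 0.
Proof.
move=> [N [mN N0 AN]]; have mC : measurable (~` annulus j : set T).
  by apply: measurableC; exact: measurable_annulus.
apply/eqP; rewrite eq_le measure_ge0 andbT -N0; apply: le_measure; rewrite ?inE//.
by apply: subset_trans AN; apply: subsetC; rewrite shellE; exact: subIsetr.
Qed.

Lemma inner_capacity_ge0 (A : set 'rV[R]_n) : 0 <= inner_capacity alpha A.
Proof.
rewrite inve_ge0; apply: le_ereal_inf_tmp => _ [mu [[[rmu _] _ _] _] <-].
rewrite riesz_energyE; last exact: radon_sigma_finite.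
by apply: integral_ge0 => x _; exact: riesz_potential_ge0.
Qed.

(** The measure given by capacity_bounded_potential at t half the capacity.
    The capacity c of the shell is finite: were it not, the potentials at the
    origin of these measures, which are at least q^((j+1)(alpha - n)) t / 2,
    could not be bounded independently of t. *)
Lemma shell_measure (A : set 'rV[R]_n) (j : nat) :
  exists gam : {measure set T -> \bar R},
    [/\ concentrated_on gam (shell q 0%R A j), gam setT < +oo,
      forall x, riesz_potential alpha gam x <= (2 `^ (- p) * 2)%:E &
      inner_capacity alpha (shell q 0%R A j)
        / (q `^ (j%:R * (n%:R - alpha)))%:E <=
      (4 * q `^ (- p))%:E * riesz_potential alpha gam 0%R].
Proof.
set c := inner_capacity _ _; set C0 : R := (2 `^ (- p) * 2)%R.
have C00 : (0 <= C0)%R by rewrite mulr_ge0// powR_ge0.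
pose w := ((q ^+ j.+1) `^ p)%R.
have w0 : (0 < w)%R by rewrite powR_gt0// exprn_gt0.
have wE : ((q `^ (j%:R * (n%:R - alpha)))^-1 = q `^ (- p) * w)%R.
  rewrite /w -powRN -powR_mulrn ?ltW// -powRrM -powRD; last first.
    by apply/implyP => _; rewrite gt_eqF.
  by congr (_ `^ _)%R; rewrite -natr1; ring.
have mass (gam : {measure set T -> \bar R}) :
    concentrated_on gam (shell q 0%R A j) ->
    w%:E * gam setT <= riesz_potential alpha gam 0%R.
  move=> /concentrated_annulus gam0; apply: (potential_ge_mass an) gam0 _ _.
  - exact: measurable_annulus.
  - by rewrite exprn_ge0// ltW.
  - by move=> y /= /andP[_ /ltW].
have [c0|c0] := eqVneq c 0.
  have pot0 x : riesz_potential alpha (@mzero _ T R) x = 0.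
    exact: integral_measure_zero.
  (* the zero measure is used where the capacity gives no nonzero measure *)
  exists mzero; split => [||x|].
  - by exists setT; split.
  - by rewrite /mzero ltry.
  - by rewrite pot0 lee_fin.
  - by rewrite pot0 mule0 c0 mul0e.
have cgt0 : 0 < c by rewrite lt0e c0 inner_capacity_ge0.
have bound (t : R) : (0 < t)%R -> t%:E < c -> (w * (t / 2) <= C0)%R.
  move=> t0 /(capacity_bounded_potential an t0)[gam [gA gm _ gC]].
  rewrite -lee_fin; apply: le_trans (gC 0%R); apply: le_trans (mass _ gA).
  by rewrite EFinM lee_pmul2l// lte_fin.
have cfin : c \is a fin_num.
  rewrite ge0_fin_numE ?ltW//; rewrite ltey; apply/eqP => coo.
  have := bound (2 * (C0 + 1) / w)%R.
  rewrite coo ltry => /(_ _ isT); rewrite divr_gt0 ?mulr_gt0 ?ltr_wpDl//.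
  move=> /(_ isT).
  rewrite (_ : w * _ = C0 + 1)%R; first by lra.
  by field; rewrite gt_eqF.
pose r := fine c; have cE : c = r%:E by rewrite fineK.
have r0 : (0 < r)%R by rewrite -lte_fin -cE.
have r2 : (0 < r / 2)%R by rewrite divr_gt0.
have [|gam [gA gm goo gC]] := @capacity_bounded_potential _ _ _ an (shell q 0%R A j) _ r2.
  by rewrite -/c cE lte_fin ltr_pdivrMr// ltr_pMr// ltr1n.
exists gam; split => //.
apply: (@le_trans _ _ ((4 * q `^ (- p))%:E * (w%:E * gam setT))); last first.
  by rewrite lee_pmul2l ?mass// lte_fin mulr_gt0// powR_gt0.
apply: (@le_trans _ _ ((4 * q `^ (- p))%:E * (w%:E * (r / 2 / 2)%:E))); last first.
  rewrite lee_pmul2l// ?lte_fin ?mulr_gt0 ?powR_gt0//.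
  by rewrite lee_pmul2l// lte_fin.
rewrite cE inver gt_eqF ?powR_gt0// wE -!EFinM lee_fin.
by rewrite le_eqVlt; apply/orP; left; apply/eqP; field.
Qed.

End shells.

(** * Potentials of sums over shells *)

Lemma expr_unbounded (R : realType) (q x : R) : 1 < q -> exists m, x <= q ^+ m.
Proof.
move=> q1.
have bernoulli m : 1 + m%:R * (q - 1) <= q ^+ m.
  elim: m => [|m IH]; first by rewrite mul0r addr0 expr0.
  rewrite exprS -natr1.
  have qm : 1 <= q ^+ m by rewrite exprn_ege1// ltW.
  nra.
exists (Num.truncn (x / (q - 1))).+1; apply: le_trans (bernoulli _).
rewrite ler_wpDl// -ler_pdivrMr ?subr_gt0//.
by rewrite ltW// truncnS_gt.
Qed.

Section annular_measures.
Context (R : realType) (n : nat) (alpha : R) (an : alpha < n%:R).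
Context (q : R) (q1 : 1 < q).
Local Notation T := (borelRn R n).
Context (gam : nat -> {measure set T -> \bar R}) (C : R).
Hypothesis gam0 : forall j, gam j (~` annulus q j) = 0%E.
Hypothesis gamC : forall j x, (riesz_potential alpha (gam j) x <= C%:E)%E.

Let q0 : 0 < q. Proof. exact: lt_trans q1. Qed.

Definition origin_potential j : R := fine (riesz_potential alpha (gam j) 0).

Local Notation s := origin_potential.

Lemma origin_potentialE j : riesz_potential alpha (gam j) 0 = (s j)%:E.
Proof.
rewrite fineK// ge0_fin_numE ?riesz_potential_ge0//.
by rewrite (le_lt_trans (gamC j 0))// ltry.
Qed.

Lemma origin_potential_ge0 j : 0 <= s j.
Proof. by rewrite -lee_fin -origin_potentialE riesz_potential_ge0. Qed.

Let C0 : 0 <= C.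
Proof.
rewrite -lee_fin; apply: le_trans (gamC 0%N 0); exact: riesz_potential_ge0.
Qed.

(** At a given x, the indices j fall into three kinds.  If the j-th annulus is
    much farther from the origin than x, or much closer, its measure has at x a
    potential at most lam times its potential at the origin.  The remaining
    indices satisfy q^j < L |x| < L^2 q^(j+1), so they lie in a window of
    length m with q^m >= L^2 q; each contributes at most C. *)
Lemma sum_potential_le (lam : R) : 1 < lam -> exists K : R, forall N M x,
  (\sum_(N <= j < M) riesz_potential alpha (gam j) x <=
   (lam * (\sum_(N <= j < M) s j) + K)%:E)%E.
Proof.
move=> lam1; have lam0 : 0 < lam by exact: lt_trans lam1.
have [L L1 almost] := riesz_kernel_almost_const an lam1.
have L0 : 0 < L by exact: lt_le_trans L1.
have [m Lm] := expr_unbounded (L ^+ 2 * q) q1.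
exists (C * m%:R) => N M x.
(* the annulus number j and x are of the same order of magnitude *)
pose near j := (q ^+ j < L * edist 0 x) && (edist 0 x < L * q ^+ j.+1).
have near_window i j : near i -> near j -> (i <= j)%N -> (j < i + m)%N.
  move=> /andP[_ xi] /andP[jx _] _; rewrite ltnNge; apply/negP => imj.
  have : q ^+ (i + m) <= q ^+ j by rewrite ler_eXn2l.
  have qi0 : 0 < q ^+ i by exact: exprn_gt0.
  rewrite exprD leNgt => /negP; apply; apply: (lt_le_trans jx).
  apply: (@le_trans _ _ (q ^+ i * (L ^+ 2 * q))); last by rewrite ler_pM2l.
  apply: (@le_trans _ _ (L * (L * q ^+ i.+1))); first by rewrite ler_pM2l// ltW.
  by rewrite exprS le_eqVlt; apply/orP; left; apply/eqP; ring.
have le1 j : (riesz_potential alpha (gam j) x <=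
    (lam * s j + C * (near j)%:R)%:E)%E.
  have [jx|] := boolP (near j).
    apply: (le_trans (gamC _ _)); rewrite lee_fin mulr1 lerDr.
    by rewrite mulr_ge0 ?origin_potential_ge0// ltW.
  rewrite negb_and -!leNgt mulr0 addr0 EFinM -origin_potentialE => far.
  apply: (potential_compare (measurable_annulus q j) (gam0 j) (ltW lam0)).
  move=> y /= /andP[qy yq]; apply: (almost x y).2.
  case/orP: far => [Lx|xL]; [left; exact: le_trans qy|right].
  by apply: le_trans xL; rewrite ler_pM2l// ltW.
apply: (@le_trans _ _ (\sum_(N <= j < M) (lam * s j + C * (near j)%:R)%:E)%E).
  by apply: lee_sum => j _; exact: le1.
rewrite sumEFin lee_fin big_split/= -!mulr_sumr lerD2l ler_wpM2l//.
by rewrite -natr_sum ler_nat; exact: sum_bool_window.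
Qed.

(** N is chosen so large that the cube is much closer to the origin than the
    annuli of index at least N. *)
Lemma sum_potential_ge (lam k : R) : 1 < lam -> exists N, forall M (x : 'rV[R]_n),
  cube k x -> ((\sum_(N <= j < M) s j)%:E <=
  lam%:E * \sum_(N <= j < M) riesz_potential alpha (gam j) x)%E.
Proof.
move=> lam1; have lam0 : 0 < lam by exact: lt_trans lam1.
have [L L1 almost] := riesz_kernel_almost_const an lam1.
have L0 : 0 < L by exact: lt_le_trans L1.
have [N LN] := expr_unbounded (L * (n%:R * k)) q1.
exists N => M x /edist0_cube xk.
rewrite ge0_sume_distrr; last by move=> j _; exact: riesz_potential_ge0.
rewrite -sumEFin big_nat_cond [leRHS]big_nat_cond; apply: lee_sum => j /andP[/andP[Nj _] _].
rewrite -origin_potentialE.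
apply: (potential_compare (measurable_annulus q j) (gam0 j) (ltW lam0)).
move=> y /= /andP[qy _]; apply: (almost x y).1.
apply: le_trans qy; apply: (@le_trans _ _ (q ^+ N)); last by rewrite ler_eXn2l.
by apply: le_trans LN; rewrite ler_pM2l.
Qed.

End annular_measures.

(** * Comparison of total masses *)

Section mass.
Context (R : realType) (n : nat) (alpha : R) (an : alpha < n%:R).
Local Notation T := (borelRn R n).
Local Open Scope ereal_scope.

Lemma le_integral_potential (gam mu nu : {measure set T -> \bar R})
    (A : set 'rV[R]_n) (C : R) :
  gam setT < +oo -> concentrated_on gam A ->
  (forall x, riesz_potential alpha gam x <= C%:E) ->
  sigma_finite setT mu -> sigma_finite setT nu ->
  nearly_everywhere alpha A
    (fun x => riesz_potential alpha mu x <= riesz_potential alpha nu x) ->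
  \int[gam]_(x in setT) riesz_potential alpha mu x <=
  \int[gam]_(x in setT) riesz_potential alpha nu x.
Proof.
move=> goo gA gC smu snu ne.
have mpot (m : {measure set T -> \bar R}) : sigma_finite setT m ->
    measurable_fun setT (riesz_potential alpha m : T -> \bar R).
  exact: measurable_riesz_potential.
pose D : set T :=
  [set x : T | riesz_potential alpha nu x < riesz_potential alpha mu x].
have mD : measurable D.
  by rewrite /D -[X in measurable X]setTI; apply: measurable_lte => //; exact: mpot.
have D0 : gam D = 0.
  apply: (bounded_potential_null goo gA gC mD); rewrite -[RHS]ne; congr inner_capacity.
  apply/seteqP; split => x [Ax]; rewrite /D/=.
    by rewrite ltNge => /negP.
  by move=> /negP; rewrite -ltNge.
apply: ae_ge0_le_integral => //.
- by move=> x _; exact: riesz_potential_ge0.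
- exact: mpot.
- by move=> x _; exact: riesz_potential_ge0.
- exact: mpot.
exists D; split => // x /= /not_implyP[_ /negP]; rewrite -ltNge; exact.
Qed.

(** By symmetry of the mutual energy, the comparison of the potentials of mu and
    nu becomes a comparison of integrals against mu and nu of one function. *)
Lemma le_integral_sum_potential (gam : nat -> {measure set T -> \bar R})
    (mu nu : {measure set T -> \bar R}) (A : set 'rV[R]_n) (C : R) N M :
  (forall j, gam j setT < +oo) -> (forall j, concentrated_on (gam j) A) ->
  (forall j x, riesz_potential alpha (gam j) x <= C%:E) ->
  sigma_finite setT mu -> sigma_finite setT nu ->
  nearly_everywhere alpha A
    (fun x => riesz_potential alpha mu x <= riesz_potential alpha nu x) ->
  \int[mu]_(x in setT) (\sum_(N <= j < M) riesz_potential alpha (gam j) x) <=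
  \int[nu]_(x in setT) (\sum_(N <= j < M) riesz_potential alpha (gam j) x).
Proof.
move=> goo gA gC smu snu ne.
have sgam j : sigma_finite setT (gam j) by exact: finite_sigma_finite.
have swap (m : {measure set T -> \bar R}) : sigma_finite setT m ->
    \int[m]_(x in setT) (\sum_(N <= j < M) riesz_potential alpha (gam j) x) =
    \sum_(N <= j < M) \int[gam j]_(x in setT) riesz_potential alpha m x.
  move=> sm; rewrite ge0_integral_sum//.
  - by apply: eq_bigr => j _; exact: integral_riesz_potentialC.
  - by move=> j; exact: measurable_riesz_potential.
  - by move=> j x _; exact: riesz_potential_ge0.
rewrite !swap//; apply: lee_sum => j _.
exact: (le_integral_potential (goo j) (gA j) (gC j)).
Qed.

(** Suppose nu(R^n) < mu(R^n).  Then b = nu(R^n) is less than a = mu(B) for some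
    cube B, and lam^2 b < a for some lam > 1.  The estimates of the potential of
    gam_N + ... + gam_(M-1), whose value at the origin is t, give
    t a <= lam (lam t + K) b, that is t (a - lam^2 b) <= lam K b, which fails
    for t large. *)
Lemma mass_le_of_unbounded (gam : nat -> {measure set T -> \bar R})
    (mu nu : {measure set T -> \bar R}) (A : set 'rV[R]_n) (q C : R) :
  (1 < q)%R -> is_radon mu -> is_radon nu ->
  (forall j, gam j setT < +oo) ->
  (forall j, concentrated_on (gam j) (shell q 0%R A j)) ->
  (forall j x, riesz_potential alpha (gam j) x <= C%:E) ->
  (forall N K, exists M,
    (K < \sum_(N <= j < M) origin_potential alpha gam j)%R) ->
  nearly_everywhere alpha A
    (fun x => riesz_potential alpha mu x <= riesz_potential alpha nu x) ->
  mu setT <= nu setT.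
Proof.
move=> q1 rmu rnu goo gA gC unb ne; rewrite leNgt; apply/negP => numu.
have smu := radon_sigma_finite rmu; have snu := radon_sigma_finite rnu.
have gAA j : concentrated_on (gam j) A.
  move: (gA j) => [N [mN N0 AN]]; exists N; split => //.
  by apply: subset_trans AN; apply: subsetC => x [].
have nufin : nu setT \is a fin_num.
  by rewrite ge0_fin_numE// (lt_le_trans numu)// leey.
pose b := fine (nu setT); have bE : nu setT = b%:E by rewrite fineK.
have mcube k : measurable (cube k : set T).
  by apply: closed_borelRn; exact: closed_cube.
have [k bk] : exists k : nat, b%:E < mu (cube k%:R).
  apply: contrapT => /forallNP nk; move: numu; rewrite bE ltNge => /negP; apply.
  have cv : mu (cube j%:R) @[j --> \oo] --> mu setT.
    rewrite -[X in mu X](@bigcup_cube R n); apply: nondecreasing_cvg_mu => //.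
      by rewrite bigcup_cube.
    move=> i j ij; apply/subsetPset => x /= xi.
    by apply: (le_trans xi); rewrite ler_nat.
  rewrite -(cvg_lim _ cv)//; apply: lime_le; first by apply/cvg_ex; exists (mu setT).
  by apply: nearW => j; rewrite leNgt; apply/negP/nk.
set B : set T := cube k%:R in bk.
have Bfin : mu B \is a fin_num.
  by rewrite ge0_fin_numE// rmu//; exact: compact_cube.
pose a := fine (mu B); have aE : mu B = a%:E by rewrite fineK.
have ba : (b < a)%R by rewrite -lte_fin -aE.
have b0 : (0 <= b)%R by rewrite -lee_fin -bE.
have a0 : (0 < a)%R by exact: le_lt_trans ba.
have [lam lam1 lamb] : exists2 lam, (1 < lam)%R & (lam ^+ 2 * b < a)%R.
  (* with b = a (1 - u), this is (1 + u / 4)^2 (1 - u) < 1 *)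
  pose u := ((a - b) / a)%R.
  have u0 : (0 < u)%R by rewrite divr_gt0// subr_gt0.
  have bu : (b = a * (1 - u))%R by rewrite /u; field; rewrite gt_eqF.
  have u1 : (u <= 1)%R by rewrite ler_pdivrMr//; lra.
  exists (1 + u / 4)%R; first by lra.
  rewrite bu mulrCA -[ltRHS]mulr1 ltr_pM2l//; nra.
have lam0 : (0 < lam)%R by exact: lt_trans lam1.
have gam0 j : gam j (~` annulus q j) = 0 by exact: concentrated_annulus (gA j).
have [K up] := sum_potential_le an q1 gam0 gC lam1.
have [N low] := sum_potential_ge an q1 gam0 gC k%:R lam1.
have C0 : (0 <= C)%R.
  by rewrite -lee_fin; apply: le_trans (gC 0%N 0%R); exact: riesz_potential_ge0.
pose gap := (a - lam ^+ 2 * b)%R; have gap0 : (0 < gap)%R by rewrite subr_gt0.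
(* this bound on t contradicts the estimates; K is made nonnegative so that
   the upper bound of the potential is too *)
have [M KM] := unb N (lam * Num.max K 0 * b / gap)%R.
set t := (\sum_(N <= j < M) _)%R in KM.
have t0 : (0 <= t)%R.
  by apply: sumr_ge0 => j _; exact: (origin_potential_ge0 (gam := gam)).
pose f (x : T) := \sum_(N <= j < M) riesz_potential alpha (gam j) x.
have f0 x : 0 <= f x by apply: sume_ge0 => j _; exact: riesz_potential_ge0.
have mf : measurable_fun setT f.
  apply: emeasurable_sum => j; apply: measurable_riesz_potential.
  exact: finite_sigma_finite.
have h1 : t%:E * a%:E <= lam%:E * \int[mu]_(x in setT) f x.
  rewrite -aE -integral_cst//; last exact: mcube.
  rewrite -ge0_integralZl_EFin//; last exact: ltW.
  apply: (@le_trans _ _ (\int[mu]_(x in B) (lam%:E * f x))).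
    apply: ge0_le_integral => //.
    - exact: mcube.
    - by apply: measurable_funTS; exact: measurable_funeM.
    - by move=> x Bx; exact: low.
  apply: ge0_subset_integral => //.
  - exact: mcube.
  - exact: measurable_funeM.
  by move=> x _; rewrite mule_ge0// lee_fin ltW.
have h2 : \int[mu]_(x in setT) f x <= \int[nu]_(x in setT) f x.
  exact: (le_integral_sum_potential N M goo gAA gC).
have K0 : (0 <= Num.max K 0)%R by rewrite le_max lexx orbT.
have h3 : \int[nu]_(x in setT) f x <= (lam * t + Num.max K 0)%:E * b%:E.
  rewrite -bE; apply: ge0_integral_bounded => //.
  - by rewrite lee_fin addr_ge0// mulr_ge0// ltW.
  - move=> x; apply: le_trans (up N M x) _; rewrite lee_fin lerD2l.
    by rewrite le_max lexx.
have : t%:E * a%:E <= lam%:E * ((lam * t + Num.max K 0)%:E * b%:E).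
  apply: le_trans h1 _; rewrite lee_pmul2l ?lte_fin//.
  exact: le_trans h2 h3.
rewrite -!EFinM lee_fin; move: KM; rewrite ltr_pdivrMr// /gap => KM h4.
have : (t * (a - lam ^+ 2 * b) <= lam * Num.max K 0 * b)%R.
  by rewrite -subr_ge0; move: h4; rewrite -subr_ge0; congr (0 <= _)%R; ring.
by rewrite leNgt KM.
Qed.

End mass.

(** * Positivity of mass *)

(** If the sums of s from N on were bounded by K, the Wiener series at the origin
    would be at most c (s_0 + ... + s_(N-1) + K). *)
Lemma unbounded_of_not_thin (R : realType) (n : nat) (alpha q c : R)
    (A : set 'rV[R]_n) (s : nat -> R) :
  ~ inner_thin_at_infinity alpha q A -> 0 <= c ->
  (forall j, (inner_capacity alpha (shell q 0 A j)
    / (q `^ (j%:R * (n%:R - alpha)))%:E <= (c * s j)%:E)%E) ->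
  forall N K, exists M, K < \sum_(N <= j < M) s j.
Proof.
move=> nthin c0 us N K; apply: contrapT => /forallNP sK.
apply: nthin; exists 0.
apply: (@le_lt_trans _ _ (c * (\sum_(0 <= j < N) s j + K))%:E); last exact: ltry.
apply: lime_le.
  apply: is_cvg_nneseries => j _ _; apply: mule_ge0.
    exact: inner_capacity_ge0.
  by rewrite inve_ge0 lee_fin powR_ge0.
exists N => // M /= NM.
apply: (@le_trans _ _ (\sum_(0 <= j < M) (c * s j)%:E)%E).
  by apply: lee_sum => j _; exact: us.
rewrite sumEFin lee_fin -mulr_sumr ler_wpM2l// (@big_cat_nat _ _ _ N)//=.
by rewrite lerD2l leNgt; apply/negP/sK.
Qed.

Unset Implicit Arguments.

Theorem theorem1p2 (R : realType) (n : nat) (hn : (2 <= n)%N)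
    (alpha : R) (alpha_gt0 : 0 < alpha) (alpha_le2 : alpha <= 2)
    (alpha_ltn : alpha < n%:R)
    (q : R) (hq : 1 < q)
    (mu nu : {measure set (borelRn R n) -> \bar R})
    (hmu : Mplus alpha mu) (hnu : Mplus alpha nu)
    (hA : exists A : set 'rV[R]_n,
        ~ inner_thin_at_infinity alpha q A /\
        nearly_everywhere alpha A
          (fun x => (riesz_potential alpha mu x <= riesz_potential alpha nu x)%E)) :
  (mu [set: borelRn R n] <= nu [set: borelRn R n])%E.
Proof.
move: hA hmu hnu => [A [nthin ne]] [rmu _] [rnu _].
have [gam gamP] := choice (shell_measure alpha_ltn hq A).
have gC j x : (riesz_potential alpha (gam j) x <= (2 `^ (- (alpha - n%:R)) * 2)%:E)%E.
  by have [_ _ ->] := gamP j.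
apply: (mass_le_of_unbounded alpha_ltn hq rmu rnu _ _ gC _ ne).
- by move=> j; have [] := gamP j.
- by move=> j; have [] := gamP j.
apply: (unbounded_of_not_thin (c := 4 * q `^ (- (alpha - n%:R))) nthin).
  by rewrite mulr_ge0// powR_ge0.
move=> j; have [_ _ _] := gamP j.
by rewrite (origin_potentialE gC) -EFinM.
Qed.
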